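(* Let $\underline{A},\overline{A}\in\mathbb{R}^{n\times n}$ with $\underline{A}\le\overline{A}$ (entrywise) and let $\mathbf{A}=\{A\in\mathbb{R}^{n\times n} : \underline{A}\le A\le\overline{A}\}$. Then $\mathbf{A}$ is strongly column sufficient if and only if for each pair of disjoint index sets $I,J\subseteq\{1,\dots,n\}$ with $I\cup J\ne\emptyset$ the system $$\begin{pmatrix}\underline{A}_{I,I}&-\overline{A}_{I,J}\\-\overline{A}_{J,I}&\underline{A}_{J,J}\end{pmatrix}x\lneqq0,\quad x>0$$ is infeasible.
   Context: Inequalities between vectors or matrices are entrywise; $x\lneqq y$ means $x\le y$ and $x\ne y$. A matrix property holds strongly for an interval matrix $\mathbf{A}$ if it holds for every $A\in\mathbf{A}$. For index sets $I,J$, $A_{I,J}$ is the submatrix of $A$ with rows indexed by $I$ and columns indexed by $J$. A matrix $A\in\mathbb{R}^{n\times n}$ is column sufficient if for each pair of disjoint index sets $I,J\subseteq\{1,\dots,n\}$ with $I\cup J\ne\emptyset$ the system $$\begin{pmatrix}A_{I,I}&-A_{I,J}\\-A_{J,I}&A_{J,J}\end{pmatrix}x\lneqq0,\quad x>0$$ is infeasible. *)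

(* Defs.v *)
From HB Require Import structures.
From mathcomp Require Import all_boot all_order all_algebra.
From mathcomp Require Import reals.

Set Implicit Arguments.
Unset Strict Implicit.
Unset Printing Implicit Defensive.

Import Order.TTheory GRing.Theory Num.Theory.
Local Open Scope ring_scope.

(* MathComp has no entrywise order on matrices: [<=] between matrices in its
   scope %MS is inclusion of row spaces. *)
Definition mx_le (R : realType) (m n : nat) (A B : 'M[R]_(m, n)) : Prop :=
  forall i j, A i j <= B i j.

Definition mx_lt (R : realType) (m n : nat) (A B : 'M[R]_(m, n)) : Prop :=
  forall i j, A i j < B i j.

(* The relation \lneqq: <= in every entry, < in at least one. *)
Definition mx_lneq (R : realType) (m n : nat) (A B : 'M[R]_(m, n)) : Prop :=
  mx_le A B /\ A <> B.

(* A_{I,J}; [enum_val] lists the elements of an index set in increasing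
   order. *)
Definition idx_submx (R : realType) (n : nat) (A : 'M[R]_n)
    (I J : {set 'I_n}) : 'M[R]_(#|I|, #|J|) :=
  mxsub (fun i : 'I_#|I| => enum_val i) (fun j : 'I_#|J| => enum_val j) A.

Definition column_sufficient (R : realType) (n : nat) (A : 'M[R]_n) : Prop :=
  forall I J : {set 'I_n}, [disjoint I & J] -> I :|: J != set0 ->
  ~ exists x : 'cV[R]_(#|I| + #|J|),
      mx_lneq (block_mx (idx_submx A I I)     (- idx_submx A I J)
                        (- idx_submx A J I)   (idx_submx A J J) *m x) 0
      /\ mx_lt 0 x.

Definition interval_mx (R : realType) (n : nat) (lA uA : 'M[R]_n)
    (A : 'M[R]_n) : Prop :=
  mx_le lA A /\ mx_le A uA.

Definition strongly (R : realType) (n : nat) (P : 'M[R]_n -> Prop)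
    (AA : 'M[R]_n -> Prop) : Prop :=
  forall A, AA A -> P A.

(* Main.v *)
(* For disjoint I and J, the interval matrix has a member A whose signed block
   matrix for (I, J) is the one of the statement: take the upper bounds on
   I x J and J x I, the lower bounds elsewhere.  Conversely that block matrix is
   entrywise below the one of every member, and products with a positive vector
   preserve this, so a solution x for a member is a solution for the bounds. *)
Require Import Defs.
From HB Require Import structures.
From mathcomp Require Import all_boot all_order all_algebra.
From mathcomp Require Import reals.

Set Implicit Arguments.
Unset Strict Implicit.
Unset Printing Implicit Defensive.

Import Order.TTheory GRing.Theory Num.Theory.
Local Open Scope ring_scope.

(** Separate arguments for diagonal and off-diagonal blocks let one form cover both systems: a
    member of the interval taken twice, or the pair of bounds. *)
Definition signed_block_mx (R : realType) (n : nat) (A B : 'M[R]_n)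
    (I J : {set 'I_n}) : 'M[R]_(#|I| + #|J|) :=
  block_mx (idx_submx A I I) (- idx_submx B I J)
           (- idx_submx B J I) (idx_submx A J J).

(** If [A = C], then [B] is squeezed between them and equals [C], which is excluded. *)
Lemma mx_le_lneq_trans (R : realType) (m n : nat) (A B C : 'M[R]_(m, n)) :
  mx_le A B -> mx_lneq B C -> mx_lneq A C.
Proof.
move=> leAB [leBC neqBC]; split=> [i j|eqAC].
  exact: le_trans (leAB i j) (leBC i j).
apply: neqBC; apply/matrixP => i j; apply/eqP.
by rewrite eq_le leBC -eqAC leAB.
Qed.

Lemma mx_le_mulmxr (R : realType) (m n p : nat) (A B : 'M[R]_(m, n))
    (X : 'M[R]_(n, p)) :
  mx_lt 0 X -> mx_le A B -> mx_le (A *m X) (B *m X).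
Proof.
move=> X_gt0 leAB i j; rewrite !mxE; apply: ler_sum => k _.
apply: ler_wpM2r (leAB i k).
by have := X_gt0 k j; rewrite mxE => /ltW.
Qed.

Lemma signed_block_mx_le (R : realType) (n : nat) (lA uA A : 'M[R]_n)
    (I J : {set 'I_n}) :
  interval_mx lA uA A -> mx_le (signed_block_mx lA uA I J) (signed_block_mx A A I J).
Proof.
move=> [leA geA] i j; rewrite /signed_block_mx.
(* Four cases, one per block; in the off-diagonal ones the minus sign turns the upper bound on [A]
   into a lower bound. *)
by rewrite -(splitK i) -(splitK j); case: (split i) => i'; case: (split j) => j';
  rewrite /= ?(block_mxEul, block_mxEur, block_mxEdl, block_mxEdr) !mxE ?lerN2.
Qed.

Definition extremal_mx (R : realType) (n : nat) (lA uA : 'M[R]_n)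
    (I J : {set 'I_n}) : 'M[R]_n :=
  \matrix_(i, j) if (i \in I) && (j \in J) || (i \in J) && (j \in I)
                 then uA i j else lA i j.

Lemma extremal_mx_interval (R : realType) (n : nat) (lA uA : 'M[R]_n)
    (I J : {set 'I_n}) :
  mx_le lA uA -> interval_mx lA uA (extremal_mx lA uA I J).
Proof. by move=> le_lu; split=> i j; rewrite mxE; case: ifP. Qed.

(** Disjointness keeps the diagonal blocks clear of [uA]: an index common to [I] and [J] would
    satisfy the test in [extremal_mx] there too. *)
Lemma signed_block_extremal_mx (R : realType) (n : nat) (lA uA : 'M[R]_n)
    (I J : {set 'I_n}) :
  [disjoint I & J] ->
  signed_block_mx (extremal_mx lA uA I J) (extremal_mx lA uA I J) I J =
  signed_block_mx lA uA I J.
Proof.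
move=> disIJ; have disJI : [disjoint J & I] by rewrite disjoint_sym.
by congr block_mx; apply/matrixP => i j; rewrite !mxE !enum_valP
  ?(disjointFr disIJ (enum_valP _)) ?(disjointFr disJI (enum_valP _))
  ?andbF ?orbT.
Qed.

Theorem proposition10 (R : realType) (n : nat) (lA uA : 'M[R]_n)
    (le_lA_uA : mx_le lA uA) :
  strongly (@column_sufficient R n) (interval_mx lA uA)
  <->
  (forall I J : {set 'I_n}, [disjoint I & J] -> I :|: J != set0 ->
   ~ exists x : 'cV[R]_(#|I| + #|J|),
       mx_lneq (block_mx (idx_submx lA I I)     (- idx_submx uA I J)
                        (- idx_submx uA J I)   (idx_submx lA J J) *m x) 0
       /\ mx_lt 0 x).
Proof.
split=> [suffA I J disIJ neIJ|infeas A intA I J disIJ neIJ] [x [lneq_x x_gt0]].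
  apply: (suffA _ (extremal_mx_interval I J le_lA_uA) I J disIJ neIJ).
  exists x; split=> //.
  by move: lneq_x; rewrite -/(signed_block_mx lA uA I J)
    -(signed_block_extremal_mx lA uA disIJ).
apply: (infeas I J disIJ neIJ); exists x; split=> //.
(* The same [x] serves: its product with the smaller matrix can only decrease, and some entry stays
   strictly negative. *)
apply: mx_le_lneq_trans lneq_x; apply: mx_le_mulmxr x_gt0 _.
exact: signed_block_mx_le.
Qed.
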